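(* Let $q$ be a prime power, let $a,K,\epsilon$ be positive integers with $a>2\epsilon$, and let $\mathbf{C}\in\mathbb{F}_q^{1\times K}$ be a nonzero row vector. Put $m=a$, $n=aK$, and let $\mathbf{A}^S=\mathbf{I}_a\otimes\mathbf{C}\in\mathbb{F}_q^{m\times n}$ be the block-diagonal matrix with $a$ copies of $\mathbf{C}$ on the diagonal. Then the optimal linear codelength of the $(\mathbf{A}^S,\epsilon)$ function update problem over $\mathbb{F}_q$ is $$l_{q,\mathrm{opt}}=m-k_q(m,2\epsilon+1).$$
   Context: Vectors are column vectors (unless stated otherwise) and $\mathrm{wt}$ denotes Hamming weight. For $\mathbf{A}\in\mathbb{F}_q^{m\times n}$ of rank $m$, in the $(\mathbf{A},\epsilon)$ function update problem over $\mathbb{F}_q$ a matrix $\mathbf{H}\in\mathbb{F}_q^{l\times n}$ is called a valid encoder matrix of codelength $l$ if there exists a function $\mathfrak{D}:\mathbb{F}_q^l\times\mathbb{F}_q^m\to\mathbb{F}_q^m$ such that $\mathfrak{D}(\mathbf{H}(\mathbf{x}+\mathbf{e}),\mathbf{A}\mathbf{x})=\mathbf{A}(\mathbf{x}+\mathbf{e})$ for all $\mathbf{x},\mathbf{e}\in\mathbb{F}_q^n$ with $\mathrm{wt}(\mathbf{e})\le\epsilon$. The optimal linear codelength $l_{q,\mathrm{opt}}$ is the minimum $l$ for which a valid encoder matrix $\mathbf{H}\in\mathbb{F}_q^{l\times n}$ exists. For integers $N,d\ge 1$, $k_q(N,d)$ denotes the maximum dimension among all linear codes over $\mathbb{F}_q$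 of blocklength $N$ and minimum distance at least $d$. *)

(* Defs.v *)
From mathcomp Require Import all_boot all_order all_algebra.
From mathcomp Require Import mxtens.
From mathcomp Require Import boolp.

Set Implicit Arguments.
Unset Strict Implicit.
Unset Printing Implicit Defensive.

Import GRing.Theory.
Local Open Scope ring_scope.

Section FunctionUpdate.

Variable F : finFieldType.

Definition wt n (x : 'cV[F]_n) : nat := #|[set i | x i ord0 != 0]|.

Definition valid_encoder m n (A : 'M[F]_(m, n)) (eps l : nat)
    (H : 'M[F]_(l, n)) : Prop :=
  exists D : 'cV[F]_l -> 'cV[F]_m -> 'cV[F]_m,
  forall x e : 'cV[F]_n, (wt e <= eps)%N ->
    D (H *m (x + e)) (A *m x) = A *m (x + e).

Lemma ex_codelength m n (A : 'M[F]_(m, n)) (eps : nat) :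
  exists l : nat, `[< exists H : 'M[F]_(l, n), valid_encoder A eps H >].
Proof.
exists n; apply/asboolP; exists 1%:M, (fun y _ => A *m y) => x e _.
by rewrite mul1mx.
Qed.

(* Meaningful for every A; the problem itself is posed for A of rank m. *)
Definition opt_codelength m n (A : 'M[F]_(m, n)) (eps : nat) : nat :=
  ex_minn (ex_codelength A eps).

(* The zero code, which has no two distinct codewords, satisfies this for
   every d. *)
Definition min_dist_geq N (V : {vspace 'cV[F]_N}) (d : nat) : Prop :=
  forall x y : 'cV[F]_N, x \in V -> y \in V -> x != y -> (d <= wt (x - y))%N.

Definition code_dim N (d k : nat) : Prop :=
  exists V : {vspace 'cV[F]_N}, min_dist_geq V d /\ \dim V = k.

Lemma ex_code_dim N d : exists k : nat, `[< code_dim N d k >].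
Proof.
exists 0%N; apply/asboolP; exists 0%VS; split; last exact: dimv0.
by move=> x y; rewrite !memv0 => /eqP-> /eqP->; rewrite eqxx.
Qed.

Lemma code_dim_leq N d (k : nat) : `[< code_dim N d k >] -> (k <= N)%N.
Proof.
move=> /asboolP[V [_ <-]].
by have := dimvS (subvf V); rewrite dimvf /dim /= muln1.
Qed.

Definition max_code_dim N d : nat :=
  ex_maxn (ex_code_dim N d) (@code_dim_leq N d).

(* The cast identifies the row index type 'I_(a * 1) of the Kronecker
   product with 'I_a. *)
Definition striped_mx (a K : nat) (C : 'rV[F]_K) : 'M[F]_(a, a * K) :=
  castmx (muln1 a, erefl (a * K)%N) ((1%:M : 'M[F]_a) *t C).

Lemma rank_striped_mx a K (C : 'rV[F]_K) :
  C != 0 -> \rank (striped_mx a C) = a.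
Proof.
move=> /rV0Pn[j Cj]; pose c : 'cV[F]_K := (C 0 j)^-1 *: delta_mx j 0.
have Cc : C *m c = 1%:M.
  apply/matrixP=> i k; rewrite !ord1 -scalemxAr -colE !mxE mulVf //.
have rk_cast p q r t (M : 'M[F]_(p, r)) (e : (p = q) * (r = t)) :
    \rank (castmx e M) = \rank M by case: e => e1 e2; case: q / e1; case: t / e2.
apply/eqP; rewrite eqn_leq rank_leq_row rk_cast /=.
have E : ((1%:M : 'M[F]_a) *t C) *m ((1%:M : 'M[F]_a) *t c) =
    (1%:M : 'M[F]_a) *t (1%:M : 'M[F]_1) by rewrite tensmx_mul mulmx1 Cc.
have := mxrankM_maxl ((1%:M : 'M[F]_a) *t C) ((1%:M : 'M[F]_a) *t c).
by rewrite E tens_mx_scalar scale1r rk_cast mxrank1.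
Qed.

End FunctionUpdate.

Arguments max_code_dim F N d : clear implicits.

(* Main.v *)
(** Subtracting two instances of the decoding condition shows that H is a valid
    encoder iff no z in ker H has the form u + d with A u = 0, wt d <= 2 eps and
    A d <> 0, so only the image A (ker H) matters.  For the striped matrix,
    d |-> A d maps the vectors of weight at most w onto those of weight at most
    w.  Hence H is valid iff the code A (ker H) has minimum distance at least
    2 eps + 1; this code has dimension at least m - l by rank-nullity.
    Conversely, if P is a parity-check matrix of a code V with that distance,
    then P A is a valid encoder with m - dim V rows. *)
Require Import Defs.
From mathcomp Require Import all_boot all_order all_algebra.
From mathcomp Require Import mxtens boolp.

Set Implicit Arguments.
Unset Strict Implicit.
Unset Printing Implicit Defensive.

Import GRing.Theory.
Local Open Scope ring_scope.

Lemma wt_sub (F : finFieldType) n (x y : 'cV[F]_n) :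
  (wt (x - y) <= wt x + wt y)%N.
Proof.
rewrite /wt; set X := [set i | x i ord0 != 0]; set Y := [set i | y i ord0 != 0].
apply: (@leq_trans #|X :|: Y|); last by rewrite cardsU leq_subr.
apply/subset_leq_card/subsetP => i; rewrite !inE !mxE; apply: contraR.
by rewrite negb_or !negbK => /andP[/eqP-> /eqP->]; rewrite subr0.
Qed.

(** Used with [s = t = eps], to turn a vector of weight at most [2 * eps] into a difference of two
    admissible errors: [e1] keeps the first [s] support positions of [d], and [- e2] keeps the
    rest. *)
Lemma wt_split (F : finFieldType) n (s t : nat) (d : 'cV[F]_n) :
  (wt d <= s + t)%N ->
  exists e1 e2 : 'cV[F]_n,
    [/\ (wt e1 <= s)%N, (wt e2 <= t)%N & d = e1 - e2].
Proof.
rewrite /wt; set X := [set i | d i ord0 != 0] => dst.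
pose X1 := [set i in take s (enum X)]; pose X2 := X :\: X1.
exists (\col_i if i \in X1 then d i ord0 else 0).
exists (\col_i if i \in X1 then 0 else - d i ord0).
have cX1 : #|X1| = minn s #|X|.
  rewrite cardsE (card_uniqP _) ?take_uniq ?enum_uniq // size_take_min.
  by rewrite -cardE.
have sX1 : X1 \subset X.
  by apply/subsetP => i; rewrite inE => /mem_take; rewrite mem_enum.
split.
- apply: (@leq_trans #|X1|); last by rewrite cX1 geq_minl.
  apply/subset_leq_card/subsetP => i; rewrite inE mxE.
  by case: (i \in X1); rewrite ?eqxx.
- apply: (@leq_trans #|X2|).
    apply/subset_leq_card/subsetP => i; rewrite !in_setD !inE mxE inE.
    by case: (i \in _); rewrite ?eqxx ?oppr_eq0.
  rewrite cardsD (setIidPr sX1) cX1 leq_subLR.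
  by case: (leqP s #|X|) => [//|/ltnW _]; rewrite leq_addr.
- apply/colP => i; rewrite !mxE (ord1 ord0).
  by case: (i \in X1); rewrite ?subr0 ?sub0r ?opprK.
Qed.

Lemma valid_encoderP (F : finFieldType) m n l (A : 'M[F]_(m, n)) eps
    (H : 'M[F]_(l, n)) :
  valid_encoder A eps H <->
  forall u d : 'cV[F]_n, A *m u = 0 -> (wt d <= eps + eps)%N ->
    H *m (u + d) = 0 -> A *m d = 0.
Proof.
split=> [[D DP] u d Au0 /wt_split[e1 [e2 [we1 we2 ->]]] /eqP|Hker].
  rewrite addrA mulmxBr subr_eq0 => /eqP Hu.
  (* Messages [u] and [0] with errors [e1] and [e2] present the same data to the decoder, so its two
     answers coincide. *)
  have := DP u e1 we1; have := DP 0 e2 we2.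
  rewrite Hu Au0 mulmx0 add0r => ->; rewrite mulmxDr Au0 add0r => Ae.
  by rewrite mulmxBr Ae subrr.
(* The decoder picks any message and error consistent with its input; the kernel condition gives all
   such pairs the same answer. The default 0 never arises on genuine data. *)
pose ok h v := [pred p : 'cV[F]_n * 'cV[F]_n |
  [&& (wt p.2 <= eps)%N, H *m (p.1 + p.2) == h & A *m p.1 == v]].
exists (fun h v => if [pick p in ok h v] is Some p then A *m (p.1 + p.2) else 0).
move=> x e we; case: pickP => [[x' e'] /=|/(_ (x, e))]; last first.
  by rewrite !inE /= we !eqxx.
rewrite inE /= => /and3P[we' /eqP He /eqP Ax]; apply/eqP.
rewrite -subr_eq0 -mulmxBr opprD addrACA mulmxDr !mulmxBr Ax subrr add0r.
rewrite -mulmxBr; apply/eqP/(Hker (x' - x)).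
- by rewrite mulmxBr Ax subrr.
- exact: leq_trans (wt_sub _ _) (leq_add _ _).
- by rewrite addrACA -opprD mulmxBr He subrr.
Qed.

Lemma min_dist_geqP (F : finFieldType) n (V : {vspace 'cV[F]_n}) d :
  min_dist_geq V d <-> forall v, v \in V -> (wt v < d)%N -> v = 0.
Proof.
split=> [Vd v Vv|Vd x y Vx Vy xy].
  rewrite ltnNge; apply: contraNeq => v0.
  by rewrite -(subr0 v); apply: Vd; rewrite ?mem0v.
rewrite leqNgt; apply: contraNN xy => /Vd xy0.
by rewrite -subr_eq0 xy0 ?rpredB.
Qed.

Lemma parity_check_exists (F : finFieldType) n (V : {vspace 'cV[F]_n}) :
  exists P : 'M[F]_(n - \dim V, n), forall y, P *m y = 0 -> y \in V.
Proof.
have dimC : \dim V^C = (n - \dim V)%N by rewrite dimv_compl dimvf /dim /= muln1.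
(* [f] projects onto the complement of [V] and vanishes only on [V]; the rows of the parity-check
   matrix are its coordinates in a basis of that complement. *)
rewrite -dimC; pose f y : 'cV[F]_n := y - projv V y.
have f_sum (I : finType) (g : I -> F) (h : I -> 'cV[F]_n) :
    f (\sum_i g i *: h i) = \sum_i g i *: f (h i).
  rewrite /f linear_sum -sumrB; apply: eq_bigr => i _.
  by rewrite linearZ scalerBr.
exists (\matrix_(i, j) coord (vbasis V^C) i (f (delta_mx j 0))) => y Py.
suff: f y = 0 by move=> /eqP; rewrite subr_eq0 => /eqP ->; exact: memv_pi.
rewrite [f y](coord_vbasis (memv_projC V y)) big1 // => i _.
rewrite -/(f y); suff -> : coord (vbasis V^C) i (f y) = 0 by rewrite scale0r.
rewrite [y]matrix_sum_delta; under eq_bigr do rewrite big_ord1.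
move/colP/(_ i): Py; rewrite !mxE; apply: etrans; rewrite f_sum linear_sum /=.
by apply: eq_bigr => j _; rewrite linearZ mxE mulrC.
Qed.

Section WeightPreserving.

Variables (F : finFieldType) (m n eps : nat) (A : 'M[F]_(m, n)).
(** [wt_image] serves to pass from codes to encoders, [wt_lift] from encoders to codes; the latter
    also makes [A] surjective. *)
Hypothesis wt_image : forall d, (wt (A *m d) <= wt d)%N.
Hypothesis wt_lift : forall y, exists2 d, A *m d = y & (wt d <= wt y)%N.

Lemma valid_encoder_of_code (V : {vspace 'cV[F]_m}) :
  min_dist_geq V (2 * eps + 1) ->
  exists H : 'M[F]_(m - \dim V, n), valid_encoder A eps H.
Proof.
move=> /min_dist_geqP Vd; have [P PV] := parity_check_exists V.
exists (P *m A); apply/valid_encoderP => u d Au0 wd.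
rewrite -mulmxA mulmxDr Au0 add0r => /PV VAd; apply: Vd => //.
by rewrite addn1 ltnS mul2n -addnn (leq_trans (wt_image d)).
Qed.

Lemma code_of_valid_encoder l (H : 'M[F]_(l, n)) :
  valid_encoder A eps H ->
  exists2 V : {vspace 'cV[F]_m},
    min_dist_geq V (2 * eps + 1) & (m - l <= \dim V)%N.
Proof.
move=> /valid_encoderP HA.
pose fA : 'Hom('cV[F]_n, 'cV[F]_m) := linfun (mulmx A).
pose fH : 'Hom('cV[F]_n, 'cV[F]_l) := linfun (mulmx H).
exists (fA @: lker fH)%VS.
  apply/min_dist_geqP => v /memv_imgP[z /[!memv_ker] Hz ->].
  rewrite lfunE /= addn1 ltnS mul2n -addnn => wz.
  (* [z] itself may be heavy, but [A *m z] is light, so a light preimage [d] splits [z] as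
     [(z - d) + d] with [z - d] in the kernel of [A]. *)
  have [d Ad wd] := wt_lift (A *m z); rewrite -Ad.
  apply: (HA (z - d)); first by rewrite mulmxBr Ad subrr.
    exact: leq_trans wz.
  by move: Hz; rewrite lfunE /= subrK => /eqP.
have dimcol k : \dim {:'cV[F]_k} = k by rewrite dimvf /dim /= muln1.
have imA : (fA @: fullv = fullv)%VS.
  apply/eqP; rewrite eqEsubv subvf; apply/subvP => y _; have [d <- _] := wt_lift y.
  by rewrite -[A *m d](lfunE (mulmx A)) memv_img ?memvf.
have := limg_ker_dim fA fullv; rewrite capfv imA !dimcol => kerA.
have := limg_ker_dim fH fullv; rewrite capfv dimcol => kerH.
have := limg_ker_dim fA (lker fH).
have /dimvS := capvSr (lker fH) (lker fA).
have /dimvS := subvf (fH @: fullv)%VS; rewrite dimcol => imH capA sumA.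
(* After adding dim ker A, the left side is n = dim ker H + rank H. Here rank H <= l, and dim ker H
   = dim (ker H ∩ ker A) + dim A(ker H). *)
rewrite leq_subLR -(leq_add2l (\dim (lker fA))) kerA.
apply: leq_trans (eq_leq (esym kerH)) _; rewrite -sumA -addnA leq_add // addnC.
by rewrite leq_add2r.
Qed.

Lemma opt_codelength_wt_preserving :
  opt_codelength A eps = (m - max_code_dim F m (2 * eps + 1))%N.
Proof.
rewrite /opt_codelength /max_code_dim.
case: ex_minnP => l /asboolP[H HA] l_min.
case: ex_maxnP => k /asboolP[V [Vd dimV]] k_max.
apply/eqP; rewrite eqn_leq; apply/andP; split.
  by apply/l_min/asboolP; rewrite -dimV; exact: valid_encoder_of_code.
have [W Wd dimW] := code_of_valid_encoder HA.
rewrite leq_subCl (leq_trans dimW) //; apply/k_max/asboolP.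
by exists W.
Qed.

End WeightPreserving.

Lemma mul_striped_mxE (F : finFieldType) a K (C : 'rV[F]_K)
    (d : 'cV[F]_(a * K)) i :
  (striped_mx a C *m d) i 0 = \sum_k C 0 k * d (mxtens_index (i, k)) 0.
Proof.
rewrite mxE (reindex (@mxtens_index a K)) /=; last first.
  by exists (@mxtens_unindex a K) => p _; rewrite (mxtens_indexK, mxtens_unindexK).
rewrite (eq_bigr (fun p => striped_mx a C i (mxtens_index (p.1, p.2)) *
                           d (mxtens_index (p.1, p.2)) 0)); last by move=> [].
rewrite -(pair_big xpredT xpredT (fun i' k => striped_mx a C i
   (mxtens_index (i', k)) * d (mxtens_index (i', k)) 0)) /=.
(* The right Kronecker factor has a single row, so undoing the cast pairs the block number with
   0. *)
have castE i' : cast_ord (esym (muln1 a)) i' = mxtens_index (i', 0 : 'I_1).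
  by apply: val_inj; rewrite /= muln1 addn0.
rewrite (bigD1 i) //= [X in _ + X]big1 ?addr0 => [|i' ii'].
  apply: eq_bigr => k _.
  by rewrite castmxE /= cast_ord_id castE tensmxE mxE eqxx mul1r.
apply: big1 => k _; rewrite castmxE /= cast_ord_id castE tensmxE mxE.
by rewrite eq_sym (negbTE ii') !mul0r.
Qed.

(** A nonzero entry [i] of the image forces a nonzero entry of [d] in block [i], so sending each
    support position of [d] to its block covers the support of the image. *)
Lemma wt_striped_mx (F : finFieldType) a K (C : 'rV[F]_K)
    (d : 'cV[F]_(a * K)) :
  (wt (striped_mx a C *m d) <= wt d)%N.
Proof.
rewrite /wt; set X := [set p | d p ord0 != 0].
apply: leq_trans (leq_imset_card (fun p => (mxtens_unindex p).1) (mem X)).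
apply/subset_leq_card/subsetP => i; rewrite inE mul_striped_mxE => Adi.
have [k dk|d0] := pickP (fun k => d (mxtens_index (i, k)) 0 != 0).
  by apply/imsetP; exists (mxtens_index (i, k)); rewrite ?inE // mxtens_indexK.
case/eqP: Adi; apply: big1 => k _; have /negbFE/eqP-> := d0 k.
by rewrite mulr0.
Qed.

(** Fix [j] with [C 0 j] nonzero and put [y i 0 / C 0 j] at position [j] of block [i], zero
    elsewhere: each block carries at most one nonzero entry. *)
Lemma striped_mx_lift (F : finFieldType) a K (C : 'rV[F]_K) (y : 'cV[F]_a) :
  C != 0 -> exists2 d, striped_mx a C *m d = y & (wt d <= wt y)%N.
Proof.
move=> /rV0Pn[j Cj].
exists (\col_p if (mxtens_unindex p).2 == j
               then y (mxtens_unindex p).1 0 / C 0 j else 0).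
  apply/colP => i; rewrite mul_striped_mxE (bigD1 j) // big1 => [|k kj].
    by apply: etrans (addr0 _) _; rewrite mxE mxtens_indexK /= eqxx mulrC divfK.
  by rewrite mxE mxtens_indexK /= (negbTE kj) mulr0.
rewrite /wt; set Y := [set i | y i ord0 != 0].
apply: leq_trans (leq_imset_card (fun i => mxtens_index (i, j)) (mem Y)).
apply/subset_leq_card/subsetP => p; rewrite inE mxE.
case: (_ =P j) => [pj yp|_]; last by rewrite eqxx.
apply/imsetP; exists (mxtens_unindex p).1; last first.
  by rewrite -pj -surjective_pairing mxtens_unindexK.
by rewrite inE; apply: contraNneq yp => ->; rewrite mul0r.
Qed.

Theorem theorem6 (F : finFieldType) (a K eps : nat)
    (a_gt0 : (0 < a)%N) (K_gt0 : (0 < K)%N) (eps_gt0 : (0 < eps)%N)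
    (a_gt : (2 * eps < a)%N) (C : 'rV[F]_K) (C_neq0 : C != 0) :
  opt_codelength (striped_mx a C) eps = (a - max_code_dim F a (2 * eps + 1))%N.
Proof.
apply: opt_codelength_wt_preserving => [d|y]; first exact: wt_striped_mx.
exact: striped_mx_lift.
Qed.
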